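(* Let $\mathcal{X}\subseteq\mathbb{R}^{d_1}$ be non-empty, closed and convex, and let $f_t,g_t:\mathcal{X}\times\mathbb{R}^{d_2}\to\mathbb{R}$, $t\in[T]$. Assume that for all $t\in[T]$ and all $\mathbf{z}=[\mathbf{x};\mathbf{y}]$, $\mathbf{z}'=[\mathbf{x}';\mathbf{y}']$ in $\mathcal{X}\times\mathbb{R}^{d_2}$: (i) $|f_t(\mathbf{z})-f_t(\mathbf{z}')|\le \ell_{f,0}\|\mathbf{z}-\mathbf{z}'\|$; (ii) $\mathbf{y}\mapsto g_t(\mathbf{x},\mathbf{y})$ is $\mu_g$-strongly convex with $\mu_g>0$; (iii) $\nabla f_t$, $\nabla g_t$, $\nabla^2 g_t$ are Lipschitz continuous in $\mathbf{z}$ with constants $\ell_{f,1},\ell_{g,1},\ell_{g,2}$ respectively; (iv) $\|\mathbf{x}-\mathbf{x}'\|\le D$ for all $\mathbf{x},\mathbf{x}'\in\mathcal{X}$ (with $D>0$), and the initialization satisfies $\|\mathbf{y}_1-\mathbf{y}_1^*(\mathbf{x}_1)\|\le D'$; (v) the functions $\mathbf{x}\mapsto f_t(\mathbf{x},\mathbf{y}_t^*(\mathbf{x}))$, $t\in[T]$, are convex on $\mathcal{X}$. Run OAGD (with window size $w=1$) with, for all $t\in[T]$, $$\beta_t=\beta=\frac{2}{\ell_{g,1}+\mu_g},\qquad \alpha_t=\frac{D}{\ell_{f,0}\sqrt t},\qquad K_t>\big\lceil 0.25(\kappa_g+1)\log 4t^2\big\rceil .$$ Then $$\mathrm{BS\text{-}Reg}_T\le\mathcal{O}\big(\sqrt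 T+\bar Y_{1,T}+\bar Y_{2,T}\big).$$
   Context: Notation: $[T]=\{1,\dots,T\}$, $\|\cdot\|$ is the Euclidean (or induced operator) norm, $\kappa_g=\ell_{g,1}/\mu_g$. Assumption (iii) implicitly includes that $f_t$ is differentiable and $g_t$ twice differentiable. $\mathbf{y}_t^*(\mathbf{x})=\arg\min_{\mathbf{y}\in\mathbb{R}^{d_2}}g_t(\mathbf{x},\mathbf{y})$. Approximate hypergradient: $\tilde\nabla f_t(\mathbf{x},\mathbf{y})=\nabla_{\mathbf{x}}f_t(\mathbf{x},\mathbf{y})+\mathbf{M}_t(\mathbf{x},\mathbf{y})\nabla_{\mathbf{y}}f_t(\mathbf{x},\mathbf{y})$, where $\mathbf{M}_t(\mathbf{x},\mathbf{y})\in\mathbb{R}^{d_1\times d_2}$ solves $\mathbf{M}_t(\mathbf{x},\mathbf{y})\nabla^2_{\mathbf{y}}g_t(\mathbf{x},\mathbf{y})+\nabla^2_{\mathbf{x}\mathbf{y}}g_t(\mathbf{x},\mathbf{y})=0$. OAGD (online alternating gradient descent) with $w=1$: start from $(\mathbf{x}_1,\mathbf{y}_1)\in\mathcal{X}\times\mathbb{R}^{d_2}$. For $t=1,\dots,T$: set $\mathbf{z}_t^1=\mathbf{y}_t$; for $k=1,\dots,K_t$ set $\mathbf{z}_t^{k+1}=\mathbf{z}_t^k-\beta_t\nabla_{\mathbf{y}}g_t(\mathbf{x}_t,\mathbf{z}_t^k)$; set $\mathbf{y}_{t+1}=\mathbf{z}_t^{K_t+1}$ and $\mathbf{x}_{t+1}=\Pi_{\mathcal{X}}[\mathbf{x}_t-\alpha_t\tilde\nabla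 f_t(\mathbf{x}_t,\mathbf{y}_{t+1})]$, with $\Pi_{\mathcal{X}}$ the Euclidean projection. Bilevel static regret: with $\mathbf{x}^*\in\arg\min_{\mathbf{x}\in\mathcal{X}}\sum_{t=1}^Tf_t(\mathbf{x},\mathbf{y}_t^*(\mathbf{x}))$, $\mathrm{BS\text{-}Reg}_T=\sum_{t=1}^T\big(f_t(\mathbf{x}_t,\mathbf{y}_t^*(\mathbf{x}_t))-f_t(\mathbf{x}^*,\mathbf{y}_t^*(\mathbf{x}^* ))\big)$. Also $\bar Y_{p,T}=\sum_{t=2}^T\|\mathbf{y}_{t-1}^*(\mathbf{x}^* )-\mathbf{y}_t^*(\mathbf{x}^* )\|^p$. The constant hidden in $\mathcal{O}$ depends only on $\ell_{f,0},\ell_{f,1},\ell_{g,1},\ell_{g,2},\mu_g,D,D'$ and not on $T$ or otherwise on the function sequence. *)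

(* Defs.v *)
From HB Require Import structures.
From mathcomp Require Export all_boot all_order all_algebra.
From mathcomp Require Export all_classical all_reals all_analysis.
Export numFieldNormedType.Exports.
Export Order.TTheory GRing.Theory Num.Theory.

#[export] Set Implicit Arguments.
#[export] Unset Strict Implicit.
#[export] Unset Printing Implicit Defensive.

Global Open Scope classical_set_scope.
Global Open Scope ring_scope.

Definition dotv {R : realType} {n : nat} (u v : 'rV[R]_n) : R :=
  \sum_i u 0 i * v 0 i.

(* The library's norm on matrices is the sup norm, hence a separate Euclidean
   norm. The topology on 'rV[R]_n is the same for both. *)
Definition enorm {R : realType} {n : nat} (u : 'rV[R]_n) : R :=
  Num.sqrt (dotv u u).

(* Operator norm induced by enorm. Matrices act on row vectors from the right;
   A and its transpose have the same operator norm. *)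
Definition opnorm {R : realType} {m n : nat} (A : 'M[R]_(m, n)) : R :=
  sup [set enorm (v *m A) | v in [set v : 'rV[R]_m | enorm v <= 1]].

(* X x R^d2, whose points [x; y] are encoded as row_mx x y. *)
Definition cylinder {R : realType} {d1 : nat} (d2 : nat)
    (X : set 'rV[R]_d1) : set 'rV[R]_(d1 + d2) :=
  [set z | X (lsubmx z)].
Arguments cylinder {R d1} d2 X.

(* Differentiability of functions that are only meant to live on S: Frechet
   expansions hold for increments that stay in S. When S has empty interior
   the derivative need not be unique, so it is a predicate. *)
Definition gradient_within {R : realType} {n : nat} (S : set 'rV[R]_n)
    (h : 'rV[R]_n -> R) (z v : 'rV[R]_n) : Prop :=
  forall e : R, 0 < e -> \forall w \near within S (nbhs z),
    `|h w - h z - dotv v (w - z)| <= e * enorm (w - z).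

(* Row-vector convention: J i j is the i-th partial derivative of the j-th
   component of h. *)
Definition jacobian_within {R : realType} {m n : nat} (S : set 'rV[R]_m)
    (h : 'rV[R]_m -> 'rV[R]_n) (z : 'rV[R]_m) (J : 'M[R]_(m, n)) : Prop :=
  forall e : R, 0 < e -> \forall w \near within S (nbhs z),
    enorm (h w - h z - (w - z) *m J) <= e * enorm (w - z).

Definition strongly_convex {R : realType} {n : nat} (mu : R)
    (h : 'rV[R]_n -> R) : Prop :=
  forall (y y' : 'rV[R]_n) (s : R), 0 <= s <= 1 ->
    h (s *: y + (1 - s) *: y') <=
      s * h y + (1 - s) * h y'
      - mu / 2 * s * (1 - s) * enorm (y - y') ^+ 2.

Definition is_argmin {R : realType} {E : Type} (A : set E) (h : E -> R)
    (a : E) : Prop :=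
  A a /\ forall b, A b -> h a <= h b.

Definition is_proj {R : realType} {n : nat} (X : set 'rV[R]_n)
    (u p : 'rV[R]_n) : Prop :=
  is_argmin X (fun q => enorm (u - q)) p.

(* M solves M * (d^2 g / dy dy) + (d^2 g / dx dy) = 0, where H is the Hessian
   of g in the joint variable [x; y]; ursubmx H has (i, j) entry
   d^2 g / (dx_i dy_j). *)
Definition solves_M {R : realType} {d1 d2 : nat} (H : 'M[R]_(d1 + d2))
    (M : 'M[R]_(d1, d2)) : Prop :=
  M *m drsubmx H + ursubmx H = 0.

(* grad_x f + M grad_y f, from the joint gradient v = [grad_x f; grad_y f];
   the transpose comes from the use of row vectors. *)
Definition hypergrad {R : realType} {d1 d2 : nat} (v : 'rV[R]_(d1 + d2))
    (M : 'M[R]_(d1, d2)) : 'rV[R]_d1 :=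
  lsubmx v + rsubmx v *m M^T.

(* x and y are the iterates of online alternating gradient descent with window
   size 1, run for rounds t = 1, ..., T. *)
Definition oagd {R : realType} {d1 d2 : nat} (X : set 'rV[R]_d1) (T : nat)
    (gradf gradg : nat -> 'rV[R]_(d1 + d2) -> 'rV[R]_(d1 + d2))
    (M : nat -> 'rV[R]_(d1 + d2) -> 'M[R]_(d1, d2))
    (alpha beta : nat -> R) (K : nat -> nat)
    (x : nat -> 'rV[R]_d1) (y : nat -> 'rV[R]_d2) : Prop :=
  X (x 1%N) /\
  forall t : nat, (1 <= t <= T)%N ->
    y t.+1 = iter (K t)
      (fun z => z - beta t *: rsubmx (gradg t (row_mx (x t) z))) (y t) /\
    let z := row_mx (x t) (y t.+1) in
    is_proj X (x t - alpha t *: hypergrad (gradf t z) (M t z)) (x t.+1).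

(* f_t at [x; y_t^*(x)], ystar t being the lower-level minimiser map y_t^*. *)
Definition outer {R : realType} {d1 d2 : nat}
    (f : nat -> 'rV[R]_(d1 + d2) -> R)
    (ystar : nat -> 'rV[R]_d1 -> 'rV[R]_d2) (t : nat) (x : 'rV[R]_d1) : R :=
  f t (row_mx x (ystar t x)).

Definition bs_regret {R : realType} {d1 d2 : nat} (T : nat)
    (f : nat -> 'rV[R]_(d1 + d2) -> R)
    (ystar : nat -> 'rV[R]_d1 -> 'rV[R]_d2)
    (x : nat -> 'rV[R]_d1) (xs : 'rV[R]_d1) : R :=
  \sum_(1 <= t < T.+1) (outer f ystar t (x t) - outer f ystar t xs).

Definition path_var {R : realType} {d1 d2 : nat} (p T : nat)
    (ystar : nat -> 'rV[R]_d1 -> 'rV[R]_d2) (xs : 'rV[R]_d1) : R :=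
  \sum_(2 <= t < T.+1) enorm (ystar t.-1 xs - ystar t xs) ^+ p.

(* Main.v *)
Require Import Defs.
From mathcomp Require Import ring lra.

(** Write [F t u] for [outer f ystar t u], [e t] for the distance from
    [y t.+1] to [ystar t (x t)], and [kappa] for [lg1 / mu].

    One round is projected gradient descent on [F t] with an inexact gradient.
    The derivative of [F t] along a segment of [X] is given by the
    hypergradient at the exact lower-level solution: the stationarity condition
    of the lower level, expanded to first order, shows that [d *m M] is the
    derivative of [ystar] in direction [d], and the chain rule follows. Since
    [F t] is convex, this derivative bounds [F t (x t) - F t xs]
    ([hypergrad_subgradient]). Replacing the exact lower-level solution by
    [y t.+1] costs a multiple of [D * e t], because the hypergradient is
    Lipschitz in the lower variable ([hypergrad_dir_lip]). The projected step
    contributes the usual telescoping term over [2 * alpha t] plus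
    [alpha t / 2] times the square of a bound on the hypergradient
    ([projected_step]). With [alpha t] of order [1 / sqrt t] these two sum to
    [O (sqrt T)].

    All estimates on derivatives are for directions [u' - u] with [u] and [u']
    in [X]. This restriction is essential: when [X] has empty interior, the
    components of the gradients and of [M] normal to its affine hull are
    arbitrary, hence not bounded by any of the constants. The projection only
    sees the directions inside [X].

    There remains the sum of the [e t]. Gradient descent with step
    [2 / (lg1 + mu)] contracts by [exp (- 2 / (kappa + 1))] or better, by
    cocoercivity ([gradient_step_contracts]), and there are enough inner steps
    to divide the initial error by at least [2 t] ([inner_rate]). The initial
    error at round [t.+1] is at most [e t] plus the distance from
    [ystar t (x t)] to [ystar t.+1 (x t.+1)]. Going through [xs], the latter is
    at most [2 * kappa * D] plus the variation of the lower-level solution at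
    [xs], since [ystar t] is [kappa]-Lipschitz. After division by
    [2 * t.+1], the constant part sums like the harmonic series, hence to
    [O (sqrt T)], and the recursion bounds the sum of the [e t] by
    [O (sqrt T)] plus [path_var 1] ([tracking_sum]). *)

(** * Euclidean norm and operator norm *)

Section Euclidean.
Variable R : realType.

Section FixedDimension.
Variable n : nat.
Implicit Types (u v w : 'rV[R]_n) (a : R).

Lemma dotvC u v : dotv u v = dotv v u.
Proof. by apply: eq_bigr => i _; rewrite mulrC. Qed.

Lemma dotvDl u v w : dotv (u + v) w = dotv u w + dotv v w.
Proof.
by rewrite /dotv -big_split; apply: eq_bigr => i _; rewrite mxE mulrDl.
Qed.

Lemma dotvZl a u v : dotv (a *: u) v = a * dotv u v.
Proof.
by rewrite /dotv big_distrr /=; apply: eq_bigr => i _; rewrite mxE mulrA.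
Qed.

Lemma dotvNl u v : dotv (- u) v = - dotv u v.
Proof. by rewrite -scaleN1r dotvZl mulN1r. Qed.

Lemma dotvDr u v w : dotv u (v + w) = dotv u v + dotv u w.
Proof. by rewrite dotvC dotvDl !(dotvC u). Qed.

Lemma dotvZr a u v : dotv u (a *: v) = a * dotv u v.
Proof. by rewrite dotvC dotvZl dotvC. Qed.

Lemma dotvNr u v : dotv u (- v) = - dotv u v.
Proof. by rewrite dotvC dotvNl dotvC. Qed.

Lemma dotv0l u : dotv 0 u = 0.
Proof. by rewrite -(scale0r u) dotvZl mul0r. Qed.

Definition dotvE := (dotvDl, dotvDr, dotvNl, dotvNr, dotvZl, dotvZr).

Lemma dotv_ge0 u : 0 <= dotv u u.
Proof. by apply: sumr_ge0 => i _; rewrite -expr2 sqr_ge0. Qed.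

Lemma enorm_ge0 u : 0 <= enorm u.
Proof. exact: sqrtr_ge0. Qed.

Lemma sqr_enorm u : enorm u ^+ 2 = dotv u u.
Proof. by rewrite sqr_sqrtr // dotv_ge0. Qed.

Lemma coord_le_enorm u i : `|u 0 i| <= enorm u.
Proof.
rewrite -sqrtr_sqr ler_wsqrtr // /dotv (bigD1 i) //= -expr2 lerDl.
by apply: sumr_ge0 => j _; rewrite -expr2 sqr_ge0.
Qed.

Lemma enorm_eq0 u : enorm u = 0 -> u = 0.
Proof.
move=> u0; apply/rowP => i; rewrite mxE; apply/eqP.
by rewrite -normr_le0 -u0 coord_le_enorm.
Qed.

Lemma enorm0 : enorm (0 : 'rV[R]_n) = 0.
Proof. by rewrite /enorm dotv0l sqrtr0. Qed.

Lemma enormZ a u : enorm (a *: u) = `|a| * enorm u.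
Proof. by rewrite /enorm !dotvE mulrA -expr2 sqrtrM ?sqr_ge0 // sqrtr_sqr. Qed.

Lemma enormN u : enorm (- u) = enorm u.
Proof. by rewrite -scaleN1r enormZ normrN1 mul1r. Qed.

Lemma enormBC u v : enorm (u - v) = enorm (v - u).
Proof. by rewrite -enormN opprB. Qed.

Lemma cauchy_schwarz u v : dotv u v <= enorm u * enorm v.
Proof.
have [->|u0] := eqVneq u 0; first by rewrite dotv0l enorm0 mul0r.
have [->|v0] := eqVneq v 0; first by rewrite dotvC dotv0l enorm0 mulr0.
have pu : 0 < enorm u.
  by rewrite lt_def enorm_ge0 andbT; apply: contra_neq u0; apply: enorm_eq0.
have pv : 0 < enorm v.
  by rewrite lt_def enorm_ge0 andbT; apply: contra_neq v0; apply: enorm_eq0.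
have := dotv_ge0 (enorm v *: u - enorm u *: v).
rewrite !dotvE -!sqr_enorm (dotvC v u).
set a := enorm u in pu *; set b := enorm v in pv *; set c := dotv u v => H.
rewrite -subr_ge0 -(@pmulr_rge0 _ (2 * (a * b))); first nra.
by rewrite mulr_gt0 // mulr_gt0.
Qed.

Lemma normr_dotv_le u v : `|dotv u v| <= enorm u * enorm v.
Proof.
rewrite ler_norml cauchy_schwarz andbT lerNl -dotvNl -(enormN u).
exact: cauchy_schwarz.
Qed.

Lemma enorm_le u a : 0 <= a -> dotv u u <= a ^+ 2 -> enorm u <= a.
Proof. by move=> a0 H; rewrite -(ger0_norm a0) -sqrtr_sqr ler_wsqrtr. Qed.

Lemma enormD u v : enorm (u + v) <= enorm u + enorm v.
Proof.
apply: enorm_le; first by rewrite addr_ge0 ?enorm_ge0.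
rewrite !dotvE -!sqr_enorm (dotvC v u).
by have := cauchy_schwarz u v; nra.
Qed.

Lemma enormB u v : enorm (u - v) <= enorm u + enorm v.
Proof. by rewrite -(enormN v) enormD. Qed.

Lemma enorm_dist u v w : enorm (u - w) <= enorm (u - v) + enorm (v - w).
Proof. by rewrite -[u - w](subrKA v) enormD. Qed.

Lemma enorm_sum (I : Type) (r : seq I) (F : I -> 'rV[R]_n) :
  enorm (\sum_(i <- r) F i) <= \sum_(i <- r) enorm (F i).
Proof.
elim: r => [|i r IH]; first by rewrite !big_nil enorm0.
by rewrite !big_cons (le_trans (enormD _ _)) // lerD2l.
Qed.

Lemma enorm_le_sum u : enorm u <= \sum_i `|u 0 i|.
Proof.
rewrite [in X in X <= _](row_sum_delta u) (le_trans (enorm_sum _ _)) //.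
apply: ler_sum => i _; rewrite enormZ ler_piMr //.
apply: enorm_le => //; rewrite /dotv (bigD1 i) //= big1 ?addr0.
  by rewrite !mxE !eqxx mulr1 expr1n.
by move=> j ji; rewrite !mxE (negbTE ji) andbF mulr0.
Qed.

End FixedDimension.

Lemma dotv_mulmx m n (u : 'rV[R]_m) (v : 'rV[R]_n) (A : 'M[R]_(m, n)) :
  dotv (u *m A) v = dotv u (v *m A^T).
Proof.
have dotvM k (a b : 'rV[R]_k) : dotv a b = (a *m b^T) 0 0.
  by rewrite mxE; apply: eq_bigr => i _; rewrite mxE.
by rewrite !dotvM trmx_mul trmxK mulmxA.
Qed.

Section Blocks.
Variables m n : nat.
Implicit Types (a c : 'rV[R]_m) (b d : 'rV[R]_n) (z : 'rV[R]_(m + n)).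

Lemma dotv_row_mx a b c d :
  dotv (row_mx a b) (row_mx c d) = dotv a c + dotv b d.
Proof.
rewrite /dotv big_split_ord; congr (_ + _); apply: eq_bigr => i _.
  by rewrite !row_mxEl.
by rewrite !row_mxEr.
Qed.

Lemma enorm_row_mx a b : enorm (row_mx a b) <= enorm a + enorm b.
Proof.
apply: enorm_le; first by rewrite addr_ge0 ?enorm_ge0.
rewrite dotv_row_mx -!sqr_enorm.
by have := enorm_ge0 a; have := enorm_ge0 b; nra.
Qed.

Lemma enorm_row_mx0 a : enorm (row_mx a (0 : 'rV[R]_n)) = enorm a.
Proof. by rewrite /enorm dotv_row_mx dotv0l addr0. Qed.

Lemma enorm_row_0mx b : enorm (row_mx (0 : 'rV[R]_m) b) = enorm b.
Proof. by rewrite /enorm dotv_row_mx dotv0l add0r. Qed.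

Lemma enorm_rsubmx z : enorm (rsubmx z) <= enorm z.
Proof.
rewrite -[in X in _ <= X](hsubmxK z) ler_wsqrtr // dotv_row_mx lerDr.
exact: dotv_ge0.
Qed.

Lemma subr_row_mx a b c d :
  row_mx a b - row_mx c d = row_mx (a - c) (b - d).
Proof. by rewrite opp_row_mx add_row_mx. Qed.

Lemma rsubmx_mul_row_mx a b (A : 'M[R]_(m + n)) :
  rsubmx (row_mx a b *m A) = a *m ursubmx A + b *m drsubmx A.
Proof.
by rewrite -[A in LHS]submxK mul_row_block row_mxKr.
Qed.

End Blocks.

(** The supremum defining the operator norm is a genuine one: the row sums of
    [A] bound the set, so every vector obeys the induced-norm inequality. *)
Lemma enorm_mulmx_le m n (A : 'M[R]_(m, n)) (v : 'rV[R]_m) :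
  enorm (v *m A) <= opnorm A * enorm v.
Proof.
have [->|v0] := eqVneq v 0; first by rewrite mul0mx !enorm0 mulr0.
have pv : 0 < enorm v.
  by rewrite lt_def enorm_ge0 andbT; apply: contra_neq v0; apply: enorm_eq0.
have -> : v *m A = enorm v *: (((enorm v)^-1 *: v) *m A).
  by rewrite -scalemxAl scalerA divff ?gt_eqF // scale1r.
rewrite enormZ ger0_norm ?enorm_ge0 // mulrC ler_wpM2r ?enorm_ge0 //.
apply: ub_le_sup; last first.
  exists ((enorm v)^-1 *: v) => //=.
  by rewrite enormZ ger0_norm ?invr_ge0 ?enorm_ge0 // mulVf // gt_eqF.
exists (\sum_i enorm (row i A)) => _ [w /= w1 <-].
rewrite mulmx_sum_row (le_trans (enorm_sum _ _)) //; apply: ler_sum => i _.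
by rewrite enormZ ler_piMl ?enorm_ge0 // (le_trans (coord_le_enorm _ _)).
Qed.

End Euclidean.

(** * First-order expansions *)

Section FirstOrder.
Variable R : realType.

Lemma small_within_enormP n (S : set 'rV[R]_n) (z : 'rV[R]_n)
    (phi : 'rV[R]_n -> R) :
  (forall e : R, 0 < e ->
     \forall w \near within S (nbhs z), phi w <= e * enorm (w - z)) <->
  (forall e : R, 0 < e -> exists2 r : R, 0 < r &
     forall w, S w -> enorm (w - z) < r -> phi w <= e * enorm (w - z)).
Proof.
split=> H e e0.
  have /nbhs_ballP[r /= r0 Hr] := H e e0.
  exists r => // w Sw wr; apply: Hr => //; split => // i j.
  rewrite (ord1 i) /ball /=; apply: le_lt_trans wr.
  by rewrite enormBC; have := coord_le_enorm (z - w) j; rewrite !mxE.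
have [r r0 Hr] := H e e0.
apply/nbhs_ballP; exists (r / n.+1%:R); first by rewrite /= divr_gt0.
move=> w [_ zw] Sw; apply: Hr => //; rewrite enormBC.
apply: (le_lt_trans (enorm_le_sum _)).
apply: (@le_lt_trans _ _ (\sum_(i < n) r / n.+1%:R)).
  by apply: ler_sum => i _; rewrite !mxE ltW //; apply: zw.
rewrite sumr_const card_ord -[_ *+ n]mulr_natr mulrAC ltr_pdivrMr ?ltr0n //.
by rewrite ltr_pM2l // ltr_nat.
Qed.

(** Every derivative below is tested along a curve that leaves [z] at finite
    speed inside [S]; there a first-order remainder is o(s). *)
Lemma small_along n (S : set 'rV[R]_n) (z : 'rV[R]_n) (phi : 'rV[R]_n -> R)
    (w : R -> 'rV[R]_n) (c : R) :
  (forall e : R, 0 < e ->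
     \forall v \near within S (nbhs z), phi v <= e * enorm (v - z)) ->
  (forall s : R, 0 < s <= 1 -> S (w s) /\ enorm (w s - z) <= c * s) ->
  forall e : R, 0 < e -> exists2 s0 : R, 0 < s0 <= 1 &
    forall s : R, 0 < s <= s0 -> phi (w s) <= e * s.
Proof.
move=> /small_within_enormP H Hw e e0.
have c0 : 0 <= c.
  have [_] := Hw 1 ltac:(by rewrite ltr01 lexx).
  by rewrite mulr1; apply: le_trans; apply: enorm_ge0.
have c1 : 0 < c + 1 by lra.
have [r r0 Hr] := H (e / (c + 1)) ltac:(by rewrite divr_gt0).
exists (Num.min 1 (r / (c + 1))).
  by rewrite lt_min ltr01 divr_gt0 //= ge_min lexx.
move=> s /andP[s0]; rewrite le_min ler_pdivlMr // => /andP[s1 sr].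
have [Sw ws] := Hw s ltac:(by rewrite s0 s1).
apply: le_trans (Hr _ Sw _) _; first by nra.
rewrite mulrAC ler_pdivrMr // -mulrA; apply: ler_wpM2l; first exact: ltW.
by nra.
Qed.

Lemma ler_add_eps (a b c : R) :
  (forall e : R, 0 < e -> a <= b + c * e) -> a <= b.
Proof.
move=> H; apply/ler_addgt0Pr => e e0.
have := H (e / (`|c| + 1)) ltac:(by rewrite divr_gt0 // ltr_wpDl).
move=> /le_trans; apply; rewrite lerD2l mulrA ler_pdivrMr ?ltr_wpDl //.
by have := ler_norm c; nra.
Qed.

End FirstOrder.

(** * Gradient descent on a smooth strongly convex function *)

Lemma addr_subl (V : zmodType) (a b : V) : a + b - a = b.
Proof. by rewrite addrAC subrr add0r. Qed.

Section SmoothStronglyConvex.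
Variables (R : realType) (n : nat) (h : 'rV[R]_n -> R).
Variables (G : 'rV[R]_n -> 'rV[R]_n) (mu L : R).
Hypothesis mu0 : 0 < mu.
Hypothesis L0 : 0 <= L.
Hypothesis h_sc : strongly_convex mu h.
Hypothesis h_grad : forall y, gradient_within setT h y (G y).

Lemma strongly_convex_lower y y' :
  h y + dotv (G y) (y' - y) + mu / 2 * enorm (y' - y) ^+ 2 <= h y'.
Proof.
set d : 'rV[R]_n := y' - y.
apply: (@ler_add_eps _ _ _ (1 + mu / 2 * enorm d ^+ 2)) => e e0.
have [s0 /andP[s0_gt0 s0_le1] Hs] : exists2 s0 : R, 0 < s0 <= 1 &
    forall s : R, 0 < s <= s0 ->
      `|h (y + s *: d) - h y - dotv (G y) (y + s *: d - y)| <= e * s.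
  apply: (@small_along _ _ setT y
    (fun w => `|h w - h y - dotv (G y) (w - y)|) _ (enorm d)) => //.
    exact: h_grad.
  move=> s /andP[s_gt0 _]; split=> //.
  by rewrite addr_subl enormZ gtr0_norm // mulrC.
set s := Num.min s0 e.
have s_gt0 : 0 < s by rewrite lt_min s0_gt0.
have s_s0 : s <= s0 by rewrite ge_min lexx.
have s_e : s <= e by rewrite ge_min lexx orbT.
have s1 : s <= 1 := le_trans s_s0 s0_le1.
have := Hs s ltac:(by rewrite s_gt0 s_s0).
have := h_sc y' y (s := s) ltac:(by rewrite ltW).
have -> : s *: y' + (1 - s) *: y = y + s *: d.
  by rewrite /d scalerBl scale1r scalerBr addrCA.
rewrite -/d addr_subl dotvZr ler_norml => Hc /andP[Hl _].
have d2 := sqr_ge0 (enorm d).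
set q := enorm d ^+ 2 in Hc d2 *; set p := dotv (G y) d in Hl *.
rewrite -subr_ge0 -(@pmulr_rge0 _ s) //.
have : 0 <= mu / 2 * q * s * (e - s).
  apply: mulr_ge0; last by rewrite subr_ge0.
  apply: mulr_ge0 (ltW s_gt0); apply: mulr_ge0 => //.
  by rewrite divr_ge0 // ltW.
nra.
Qed.

Lemma argmin_gradient0 y : is_argmin setT h y -> G y = 0.
Proof.
move=> [_ hy]; apply: enorm_eq0; apply/eqP.
suff: enorm (G y) ^+ 2 <= 0.
  by move=> H; rewrite -sqrf_eq0 eq_le H sqr_ge0.
apply: (@ler_add_eps _ _ _ 1) => e e0; rewrite add0r mul1r.
have [s0 /andP[s0_gt0 _] Hs] : exists2 s0 : R, 0 < s0 <= 1 &
    forall s : R, 0 < s <= s0 ->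
      `|h (y - s *: G y) - h y - dotv (G y) (y - s *: G y - y)| <= e * s.
  apply: (@small_along _ _ setT y
    (fun w => `|h w - h y - dotv (G y) (w - y)|) _ (enorm (G y))) => //.
    exact: h_grad.
  move=> s /andP[s_gt0 _]; split=> //.
  by rewrite addr_subl enormN enormZ gtr0_norm // mulrC.
have := Hs s0 ltac:(by rewrite s0_gt0 lexx).
rewrite addr_subl dotvNr dotvZr -sqr_enorm ler_norml => /andP[_ H].
have hs : h y <= h (y - s0 *: G y) by apply: hy.
by rewrite -(ler_pM2r s0_gt0); nra.
Qed.

Lemma gradient_strongly_monotone y y' :
  mu * enorm (y - y') ^+ 2 <= dotv (G y - G y') (y - y').
Proof.
have := strongly_convex_lower y y'; have := strongly_convex_lower y' y.
rewrite -(opprB y y') enormN dotvNr dotvDl dotvNl.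
by lra.
Qed.

Hypothesis G_lip : forall y y', enorm (G y - G y') <= L * enorm (y - y').

(** Discretisation of the integral of the slope over the segment: cutting it
    into [N] equal pieces and bounding the increment over each piece by the
    slope at its far end gives the constant [L / 2 * (1 + 1 / N)], and [N] is
    arbitrary. *)
Lemma descent_lemma y y' :
  h y' <= h y + dotv (G y) (y' - y) + L / 2 * enorm (y' - y) ^+ 2.
Proof.
set d : 'rV[R]_n := y' - y.
have step (N k : nat) : (0 < N)%N -> h (y + (k%:R / N%:R) *: d) <=
    h y + k%:R / N%:R * dotv (G y) d
    + L * enorm d ^+ 2 * (k%:R * (k%:R + 1)) / (2 * N%:R ^+ 2).
  move=> N0; have NR : (0 : R) < N%:R by rewrite ltr0n.
  elim: k => [|k IH].
    by rewrite mul0r scale0r addr0 mul0r !mul0r mulr0 mul0r !addr0.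
  set a := y + (k.+1%:R / N%:R) *: d; set b := y + (k%:R / N%:R) *: d in IH *.
  have ba : b - a = - (N%:R^-1 *: d).
    rewrite /a /b opprD addrACA subrr add0r -scalerBl -[RHS]scaleNr.
    by congr (_ *: _); rewrite -natr1; field; rewrite gt_eqF.
  have ay : a - y = (k.+1%:R / N%:R) *: d by rewrite /a addr_subl.
  have Ha := strongly_convex_lower a b.
  have sl : dotv (G a) d <= dotv (G y) d + L * (k.+1%:R / N%:R) * enorm d ^+ 2.
    rewrite -lerBlDl -dotvNl -dotvDl (le_trans (cauchy_schwarz _ _)) //.
    rewrite expr2 mulrA ler_wpM2r ?enorm_ge0 // (le_trans (G_lip _ _)) //.
    by rewrite ay enormZ ger0_norm ?mulrA // divr_ge0.
  rewrite ba dotvNr dotvZr in Ha.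
  have q0 : 0 <= mu / 2 * enorm (- (N%:R^-1 *: d)) ^+ 2.
    by rewrite mulr_ge0 ?sqr_ge0 // divr_ge0 // ltW.
  have {q0}Ha : h a <= h b + N%:R^-1 * dotv (G a) d by lra.
  apply: le_trans Ha _; apply: (le_trans (lerD IH (lexx _))).
  have iN : 0 <= N%:R^-1 :> R by rewrite invr_ge0 ltW.
  apply: (le_trans (lerD (lexx _) (ler_wpM2l iN sl))).
  rewrite le_eqVlt; apply/orP; left; apply/eqP; rewrite -!natr1.
  by field; rewrite gt_eqF.
apply: (@ler_add_eps _ _ _ (L * enorm d ^+ 2 / 2)) => e e0.
set N := (Num.truncn e^-1).+1.
have N0 : (0 < N)%N by [].
have NR : (0 : R) < N%:R by rewrite ltr0n.
have Ne : e^-1 < N%:R by apply: truncnS_gt.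
have iNe : N%:R^-1 <= e.
  by rewrite -[e]invrK ler_pV2 ?ltW // inE ?unitfE ?gt_eqF ?invr_gt0 // ?NR.
have := step N N N0; rewrite divff ?gt_eqF // scale1r /d addrC subrK -/d mul1r.
move=> /le_trans; apply; rewrite -!addrA !lerD2l.
have -> : L * enorm d ^+ 2 * (N%:R * (N%:R + 1)) / (2 * N%:R ^+ 2) =
    L / 2 * enorm d ^+ 2 + L * enorm d ^+ 2 / 2 * N%:R^-1.
  by field; rewrite gt_eqF.
by rewrite lerD2l ler_wpM2l // divr_ge0 // mulr_ge0 // sqr_ge0.
Qed.

(** Cocoercivity of the gradient of [h - mu/2 |.|^2], which is convex and has
    curvature at most [L - mu]. At the point reached from [y] by a step of
    length [s] against the gradient difference, the quadratic lower bound at [x]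
    cannot exceed the quadratic upper bound at [y]; exchanging [x] and [y] and
    adding gives the claim. The usual form is [s = 1 / (L - mu)]; for [L <= mu]
    a large [s] forces the gradient difference to vanish. *)
Lemma shifted_gradient_cocoercive x y s :
  let d := y - x in let w := G y - G x - mu *: d in
  (2 * s - (L - mu) * s ^+ 2) * enorm w ^+ 2 <= dotv w d.
Proof.
have half a b : let d := b - a in let w := G b - G a - mu *: d in
    h a - h b + dotv (G a) d + mu / 2 * enorm d ^+ 2 <=
    ((L - mu) / 2 * s ^+ 2 - s) * enorm w ^+ 2.
  move=> d w.
  have dE : d = b - a by [].
  have wE : w = G b - G a - mu *: d by [].
  clearbody w d.
  have lo := strongly_convex_lower a (b - s *: w).
  have hi := descent_lemma b (b - s *: w).
  have e1 : b - s *: w - a = d - s *: w by rewrite dE addrAC.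
  have e2 : b - s *: w - b = - (s *: w) by rewrite addr_subl.
  rewrite e1 !sqr_enorm !dotvE in lo; rewrite e2 !sqr_enorm !dotvE in hi.
  rewrite !sqr_enorm.
  have ww : dotv w w = dotv (G b) w - dotv (G a) w - mu * dotv d w.
    by rewrite {1}wE !dotvE.
  rewrite (dotvC w d) in lo.
  set q := dotv w w in ww lo hi *; set p := dotv d w in ww lo.
  set u := dotv (G b) w in ww hi; set v := dotv (G a) w in ww lo.
  have {ww}-> : ((L - mu) / 2 * s ^+ 2 - s) * q =
     (L - mu) / 2 * s ^+ 2 * q - s * (u - v - mu * p) by rewrite -ww; ring.
  nra.
cbv zeta in half |- *; have := half x y; have := half y x.
set d := y - x; set w := G y - G x - mu *: d.
have dE : x - y = - d by rewrite opprB.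
have wE : w = G y - G x - mu *: d by [].
clearbody w d; rewrite dE.
have -> : G x - G y - mu *: (- d) = - w.
  by rewrite wE scalerN !opprD !opprK addrAC addrC addrA (addrC (- _)).
rewrite !enormN dotvNr !sqr_enorm.
have -> : dotv w d = dotv (G y) d - dotv (G x) d - mu * dotv d d.
  by rewrite wE !dotvE.
lra.
Qed.

(** With [w = G y - mu *: d] and [d = y - ys] the new displacement is
    [c *: d - beta *: w], where [c = (L - mu) / (L + mu)] and
    [beta = 2 / (L + mu)]. For [mu < L], cocoercivity makes the terms in [w]
    nonpositive in the squared norm, which leaves the factor
    [c <= exp (- 2 / (L / mu + 1))]. When [L <= mu], cocoercivity forces
    [w = 0], the Lipschitz bound forces [(mu - L) * |d| = 0], and the step lands
    on the minimiser. *)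
Lemma gradient_step_contracts y ys : is_argmin setT h ys ->
  enorm (y - (2 / (L + mu)) *: G y - ys) <=
    expR (- (2 / (L / mu + 1))) * enorm (y - ys).
Proof.
move=> /argmin_gradient0 Gs0.
have Lmu0 : 0 < L + mu by rewrite ltr_wpDl.
have coco := shifted_gradient_cocoercive ys y.
rewrite /= Gs0 subr0 in coco.
set d := y - ys in coco *; set g := G y in coco *.
have -> : y - (2 / (L + mu)) *: g - ys = d - (2 / (L + mu)) *: g.
  by rewrite addrAC.
set w := g - mu *: d in coco.
have gE : g = w + mu *: d by rewrite /w subrK.
have gd : enorm g <= L * enorm d by have := G_lip y ys; rewrite Gs0 subr0.
clearbody w d g; set c := (L - mu) / (L + mu).
have stepE : d - (2 / (L + mu)) *: g = c *: d - (2 / (L + mu)) *: w.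
  rewrite gE scalerDr opprD addrA addrAC scalerA -{1}[d]scale1r -scalerBl.
  by congr (_ *: _ - _); rewrite /c; field; rewrite gt_eqF.
suff H : enorm (d - (2 / (L + mu)) *: g) <= Num.max 0 c * enorm d.
  apply: le_trans H _; apply: ler_wpM2r; first exact: enorm_ge0.
  rewrite ge_max expR_ge0 /= (le_trans _ (expR_ge1Dx _)) //.
  rewrite le_eqVlt; apply/orP; left; apply/eqP; rewrite /c.
  by field; rewrite !gt_eqF.
rewrite stepE; have [muL|Lmu] := ltP mu L.
  have c0 : 0 <= c by rewrite divr_ge0 ?ltW // subr_gt0.
  have Lm0 : 0 < L - mu by rewrite subr_gt0.
  rewrite max_r //; apply: enorm_le; first by rewrite mulr_ge0 ?enorm_ge0.
  have := coco (L - mu)^-1; rewrite !dotvE exprMn !sqr_enorm (dotvC d w).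
  set q := dotv w w; set p := dotv w d; set r := dotv d d.
  have -> : 2 * (L - mu)^-1 - (L - mu) * (L - mu)^-1 ^+ 2 = (L - mu)^-1.
    by field; rewrite gt_eqF.
  rewrite mulrC ler_pdivrMr // => Hq.
  have : 0 <= (2 / (L + mu)) ^+ 2 * (p * (L - mu) - q).
    by rewrite mulr_ge0 ?sqr_ge0 ?subr_ge0.
  have -> : (2 / (L + mu)) ^+ 2 * (p * (L - mu) - q) =
      2 * c * (2 / (L + mu)) * p - (2 / (L + mu)) ^+ 2 * q.
    by rewrite /c; field; rewrite gt_eqF.
  nra.
have w0 : w = 0.
  apply: enorm_eq0; apply/eqP; rewrite -sqrf_eq0; apply/negPn/negP => q0.
  have {}q0 : 0 < enorm w ^+ 2 by rewrite lt_def q0 sqr_ge0.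
  (* the step for which cocoercivity would give 2 (|<w, d>| + 1) <= <w, d> *)
  set s := (`|dotv w d| + 1) / enorm w ^+ 2.
  have sq : s * enorm w ^+ 2 = `|dotv w d| + 1 by rewrite divfK // gt_eqF.
  have := coco s; have := ler_norm (dotv w d).
  have : 0 <= (mu - L) * s ^+ 2 * enorm w ^+ 2.
    by rewrite mulr_ge0 ?sqr_ge0 // mulr_ge0 ?sqr_ge0 // subr_ge0.
  have := normr_ge0 (dotv w d).
  nra.
have dL : mu * enorm d <= L * enorm d.
  by move: gd; rewrite gE w0 add0r enormZ gtr0_norm.
have c0 : c <= 0 by rewrite /c pmulr_lle0 ?invr_gt0 // subr_le0.
rewrite max_l // mul0r w0 scaler0 subr0 enormZ ler0_norm //.
have -> : - c * enorm d = (mu - L) * enorm d / (L + mu).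
  by rewrite /c; field; rewrite gt_eqF.
by rewrite ler_pdivrMr // mul0r mulrBl subr_le0.
Qed.

End SmoothStronglyConvex.

(** * Directional bounds on derivatives *)

Lemma gradient_lipschitz_dir (R : realType) n (S : set 'rV[R]_n)
    (h : 'rV[R]_n -> R) (z v d : 'rV[R]_n) (l : R) :
  gradient_within S h z v -> S z ->
  (forall z', S z' -> `|h z' - h z| <= l * enorm (z' - z)) ->
  (forall s : R, 0 < s <= 1 -> S (z + s *: d)) ->
  `|dotv v d| <= l * enorm d.
Proof.
move=> hv Sz h_lip Sd; apply: (@ler_add_eps _ _ _ 1) => e e0; rewrite mul1r.
have [s0 /andP[s0_gt0 s0_le1] Hs] := small_along (c := enorm d) hv
  (w := fun s => z + s *: d)
  ltac:(by move=> s s01; split; [exact: Sd | move: s01 => /andP[s_gt0 _];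
        rewrite addr_subl enormZ gtr0_norm // mulrC]) e0.
have := Hs s0 ltac:(by rewrite s0_gt0 lexx).
have := h_lip (z + s0 *: d) (Sd s0 ltac:(by rewrite s0_gt0)).
rewrite addr_subl dotvZr enormZ (gtr0_norm s0_gt0) => H1 H2.
rewrite -(ler_pM2l s0_gt0) -[s0 in leLHS](gtr0_norm s0_gt0) -normrM.
have := ler_normB (h (z + s0 *: d) - h z)
  (h (z + s0 *: d) - h z - s0 * dotv v d).
by rewrite opprB addrC subrK; nra.
Qed.

Lemma jacobian_lipschitz_dir (R : realType) m n (S : set 'rV[R]_m)
    (h : 'rV[R]_m -> 'rV[R]_n) (z d : 'rV[R]_m) (J : 'M[R]_(m, n)) (l : R) :
  jacobian_within S h z J -> S z ->
  (forall z', S z' -> enorm (h z' - h z) <= l * enorm (z' - z)) ->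
  (forall s : R, 0 < s <= 1 -> S (z + s *: d)) ->
  enorm (d *m J) <= l * enorm d.
Proof.
move=> hv Sz h_lip Sd; apply: (@ler_add_eps _ _ _ 1) => e e0; rewrite mul1r.
have [s0 /andP[s0_gt0 s0_le1] Hs] := small_along (c := enorm d) hv
  (w := fun s => z + s *: d)
  ltac:(by move=> s s01; split; [exact: Sd | move: s01 => /andP[s_gt0 _];
        rewrite addr_subl enormZ gtr0_norm // mulrC]) e0.
have := Hs s0 ltac:(by rewrite s0_gt0 lexx).
have := h_lip (z + s0 *: d) (Sd s0 ltac:(by rewrite s0_gt0)).
rewrite addr_subl -scalemxAl enormZ (gtr0_norm s0_gt0) => H1 H2.
rewrite -(ler_pM2l s0_gt0) -[s0 in leLHS](gtr0_norm s0_gt0) -enormZ.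
have := enormB (h (z + s0 *: d) - h z)
  (h (z + s0 *: d) - h z - s0 *: (d *m J)).
by rewrite opprB addrC subrK; nra.
Qed.

Lemma partial_gradient (R : realType) d1 d2 (X : set 'rV[R]_d1)
    (h : 'rV[R]_(d1 + d2) -> R) (u : 'rV[R]_d1) (b : 'rV[R]_d2) v :
  X u -> gradient_within (cylinder d2 X) h (row_mx u b) v ->
  gradient_within setT (fun b' => h (row_mx u b')) b (rsubmx v).
Proof.
move=> Xu hv; apply/small_within_enormP => e e0.
have /small_within_enormP/(_ _ e0)[r r0 Hr] := hv.
exists r => // b' _ br.
have := Hr (row_mx u b'); rewrite /cylinder /= row_mxKl.
rewrite subr_row_mx subrr enorm_row_0mx => /(_ Xu br).
by rewrite -[v in dotv v _]hsubmxK dotv_row_mx (dotvC _ 0) dotv0l add0r.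
Qed.

Lemma dotv_hypergrad (R : realType) d1 d2 (v : 'rV[R]_(d1 + d2))
    (A : 'M[R]_(d1, d2)) (d : 'rV[R]_d1) :
  dotv (hypergrad v A) d = dotv v (row_mx d (d *m A)).
Proof.
rewrite /hypergrad -[v in RHS]hsubmxK dotv_row_mx dotvDl dotv_mulmx trmxK.
by [].
Qed.

(** * Projected gradient step *)

Lemma projection_variational (R : realType) n (X : set 'rV[R]_n)
    (q p u : 'rV[R]_n) :
  (forall s : R, 0 <= s <= 1 -> X (p + s *: (u - p))) ->
  is_proj X q p -> dotv (q - p) (u - p) <= 0.
Proof.
move=> Xs [_ p_min]; apply: (@ler_add_eps _ _ _ (enorm (u - p) ^+ 2)) => e e0.
set s := Num.min 1 e.
have s_gt0 : 0 < s by rewrite lt_min ltr01.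
have s1 : s <= 1 by rewrite ge_min lexx.
have se : s <= e by rewrite ge_min lexx orbT.
have := p_min _ (Xs s ltac:(by rewrite (ltW s_gt0))).
rewrite /= opprD addrA; move: (q - p) (u - p) => a b.
rewrite -ler_sqr ?nnegrE ?enorm_ge0 // !sqr_enorm !dotvE (dotvC b a) => H.
have b0 := dotv_ge0 b.
have : 0 <= s * (e - s) * dotv b b by rewrite !mulr_ge0 ?subr_ge0 ?(ltW s_gt0).
have : 0 <= s * s * dotv b b by rewrite !mulr_ge0 ?(ltW s_gt0).
rewrite -(ler_pM2l s_gt0 (dotv a b)); lra.
Qed.

(** The basic inequality of projected gradient descent. Instead of the norm of
    [h], the bound [G] controls only its slope along the displacement [p - x],
    which stays inside [X]: this is what survives when the normal component of
    [h] is arbitrary. *)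
Lemma projected_step (R : realType) n (X : set 'rV[R]_n) (x p u h : 'rV[R]_n)
    (alpha G : R) :
  0 < alpha ->
  (forall s : R, 0 <= s <= 1 -> X (p + s *: (u - p))) ->
  is_proj X (x - alpha *: h) p ->
  `|dotv h (p - x)| <= G * enorm (p - x) ->
  dotv h (x - u) <=
    (enorm (x - u) ^+ 2 - enorm (p - u) ^+ 2) / (2 * alpha)
    + alpha / 2 * G ^+ 2.
Proof.
move=> a0 Xs /(projection_variational Xs).
rewrite (addrAC x) -(opprB x p) dotvNr normrN enormN.
have -> : u - p = - (p - u) by rewrite opprB.
have -> : x - u = (x - p) + (p - u) by rewrite addrA subrK.
move: (x - p) (p - u) => a b.
rewrite !sqr_enorm !dotvE ler_norml (dotvC b a) -(sqr_enorm a).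
set A := enorm a; set ha := dotv h a; set hb := dotv h b.
set ab := dotv a b => H1 /andP[_ H2].
have sq := sqr_ge0 (alpha * G - A).
rewrite -lerBlDr ler_pdivlMr ?mulr_gt0 //.
suff : 2 * alpha * (ha + hb) <= A ^+ 2 + 2 * ab + alpha ^+ 2 * G ^+ 2 by nra.
have := ler_wpM2l (ltW a0) H2; nra.
Qed.

(** * One round of the bilevel problem *)

Section Round.
Variables (R : realType) (d1 d2 : nat) (X : set 'rV[R]_d1).
Variables (f g : 'rV[R]_(d1 + d2) -> R).
Variables (gradf gradg : 'rV[R]_(d1 + d2) -> 'rV[R]_(d1 + d2)).
Variables (hessg : 'rV[R]_(d1 + d2) -> 'M[R]_(d1 + d2)).
Variables (M : 'rV[R]_(d1 + d2) -> 'M[R]_(d1, d2)).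
Variables (ystar : 'rV[R]_d1 -> 'rV[R]_d2).
Variables (lf0 lf1 lg1 lg2 mu : R).
Let Z := cylinder d2 X.
Hypothesis lf0_gt0 : 0 < lf0.
Hypothesis lg1_ge0 : 0 <= lg1.
Hypothesis lg2_ge0 : 0 <= lg2.
Hypothesis mu_gt0 : 0 < mu.
Hypothesis X_segment : forall u v (s : R), X u -> X v -> 0 <= s <= 1 ->
  X (u + s *: (v - u)).
Hypothesis ystar_argmin : forall u, X u ->
  is_argmin setT (fun b => g (row_mx u b)) (ystar u).
Hypothesis derivatives : forall z, Z z ->
  [/\ gradient_within Z f z (gradf z), gradient_within Z g z (gradg z),
      jacobian_within Z gradg z (hessg z) & solves_M (hessg z) (M z)].
Hypothesis f_lip : forall z z', Z z -> Z z' ->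
  `|f z - f z'| <= lf0 * enorm (z - z').
Hypothesis g_sc : forall u, X u -> strongly_convex mu (fun b => g (row_mx u b)).
Hypothesis derivatives_lip : forall z z', Z z -> Z z' ->
  [/\ enorm (gradf z - gradf z') <= lf1 * enorm (z - z'),
      enorm (gradg z - gradg z') <= lg1 * enorm (z - z') &
      opnorm (hessg z - hessg z') <= lg2 * enorm (z - z')].

Let Gy u b := rsubmx (gradg (row_mx u b)).
Let kappa := lg1 / mu.

Let kappa_ge0 : 0 <= kappa.
Proof. by rewrite divr_ge0 // ltW. Qed.

Lemma cylinder_row_mx u b : X u -> Z (row_mx u b).
Proof. by rewrite /Z /cylinder /= row_mxKl. Qed.

Lemma cylinder_segment u u' b b' (s : R) : X u -> X u' -> 0 < s <= 1 ->
  Z (row_mx u b + s *: row_mx (u' - u) b').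
Proof.
move=> Xu Xu' /andP[s0 s1]; rewrite scale_row_mx add_row_mx.
by apply/cylinder_row_mx/X_segment; rewrite // s1 ltW.
Qed.

Lemma inner_gradient u b : X u ->
  gradient_within setT (fun b' => g (row_mx u b')) b (Gy u b).
Proof.
move=> Xu; apply: (partial_gradient (X := X)) => //.
by have [] := derivatives (cylinder_row_mx b Xu).
Qed.

Lemma inner_gradient_lip u u' b b' : X u -> X u' ->
  enorm (Gy u b - Gy u' b') <= lg1 * enorm (row_mx (u - u') (b - b')).
Proof.
move=> Xu Xu'; rewrite -subr_row_mx.
have [_ H _] := derivatives_lip (cylinder_row_mx b Xu) (cylinder_row_mx b' Xu').
apply: le_trans H.
have := enorm_rsubmx (gradg (row_mx u b) - gradg (row_mx u' b')).
by rewrite linearB.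
Qed.

Lemma inner_gradient_monotone u b b' : X u ->
  mu * enorm (b - b') ^+ 2 <= dotv (Gy u b - Gy u b') (b - b').
Proof.
move=> Xu; apply: (gradient_strongly_monotone mu_gt0 (g_sc Xu)) => c.
exact: inner_gradient.
Qed.

Lemma inner_gradient_ystar u : X u -> Gy u (ystar u) = 0.
Proof.
move=> Xu; apply: (argmin_gradient0 _ (ystar_argmin Xu)) => c.
exact: inner_gradient.
Qed.

Lemma ystar_lip u u' : X u -> X u' ->
  enorm (ystar u - ystar u') <= kappa * enorm (u - u').
Proof.
move=> Xu Xu'; set a := enorm _.
have := inner_gradient_monotone (ystar u) (ystar u') Xu.
rewrite inner_gradient_ystar // -(inner_gradient_ystar Xu').
move=> /le_trans/(_ (cauchy_schwarz _ _)).
have := inner_gradient_lip (ystar u') (ystar u') Xu' Xu.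
rewrite subrr enorm_row_mx0 enormBC (enormBC u') -/a => H1 H2.
have [->|a0] := eqVneq a 0; first by rewrite mulr_ge0 ?enorm_ge0.
have ap : 0 < a by rewrite lt_def a0 enorm_ge0.
rewrite /kappa mulrAC ler_pdivlMr // mulrC.
rewrite -(ler_pM2r ap) -mulrA -expr2; apply: le_trans H2 _.
by rewrite ler_wpM2r ?enorm_ge0 // enormBC.
Qed.

(** Dividing the strong monotonicity of the partial gradient along
    [b + s *: c] by [s ^+ 2] gives [mu * |c|^2 <= <c H, c>] for the lower
    Hessian block [H]; by Cauchy-Schwarz, [H] is bounded from below. *)
Lemma hess_yy_lower u b c : X u ->
  mu * enorm c <= enorm (c *m drsubmx (hessg (row_mx u b))).
Proof.
move=> Xu; set H := hessg _; set A := drsubmx H.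
suff Hc : mu * enorm c ^+ 2 <= dotv (c *m A) c.
  have [->|c0] := eqVneq (enorm c) 0; first by rewrite mulr0 enorm_ge0.
  have cp : 0 < enorm c by rewrite lt_def c0 enorm_ge0.
  rewrite -(ler_pM2r cp) -mulrA -expr2; apply: le_trans Hc _.
  exact: cauchy_schwarz.
apply: (@ler_add_eps _ _ _ (enorm c)) => e e0.
have [_ _ hJ _] := derivatives (cylinder_row_mx b Xu).
have [s /andP[s_gt0 s_le1] Hs] := small_along (c := enorm c) hJ
  (w := fun s => row_mx u (b + s *: c))
  ltac:(by move=> s /andP[s_gt0 _]; split; [exact: cylinder_row_mx |
    rewrite subr_row_mx subrr addr_subl enorm_row_0mx enormZ gtr0_norm //
      mulrC])
  e0.
have := Hs s ltac:(by rewrite s_gt0 lexx).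
move=> /(le_trans (enorm_rsubmx _)).
rewrite !linearB /= subr_row_mx rsubmx_mul_row_mx subrr mul0mx add0r.
rewrite addr_subl -/(Gy _ _).
rewrite -/(Gy _ _) -/H -/A -scalemxAl => H1.
have := inner_gradient_monotone (b + s *: c) b Xu.
rewrite addr_subl enormZ gtr0_norm // dotvZr => H2.
have := cauchy_schwarz (Gy u (b + s *: c) - Gy u b - s *: (c *m A)) c.
rewrite dotvDl dotvNl dotvZl => H3.
have H4 := ler_wpM2r (enorm_ge0 c) H1.
rewrite exprMn in H2.
have H5 : s * (mu * enorm c ^+ 2) <= dotv (Gy u (b + s *: c) - Gy u b) c.
  rewrite -(ler_pM2l s_gt0); apply: le_trans H2; rewrite le_eqVlt.
  by apply/orP; left; apply/eqP; ring.
rewrite -(ler_pM2l s_gt0); lra.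
Qed.

(** [d *m M] is the derivative of [ystar] in the direction [d]. Only directions
    pointing from [u] into [X] are controlled: the components of [M] and of the
    gradients that are normal to the affine hull of [X] are arbitrary. *)
Lemma implicit_dir_bound u u' b : X u -> X u' ->
  enorm ((u' - u) *m M (row_mx u b)) <= kappa * enorm (u' - u).
Proof.
move=> Xu Xu'; set d := u' - u; set z := row_mx u b.
have Zz : Z z by exact: cylinder_row_mx.
have [_ _ hJ hM] := derivatives Zz.
have := hess_yy_lower b (d *m M z) Xu; rewrite -/z.
have -> : d *m M z *m drsubmx (hessg z) = - (d *m ursubmx (hessg z)).
  by rewrite -(addr0_eq hM) mulmxN opprK mulmxA.
rewrite enormN /kappa mulrAC ler_pdivlMr // mulrC => /le_trans; apply.
have -> : d *m ursubmx (hessg z) = rsubmx (row_mx d 0 *m hessg z).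
  by rewrite rsubmx_mul_row_mx mul0mx addr0.
apply: (le_trans (enorm_rsubmx _)); rewrite -(enorm_row_mx0 d2 d).
apply: (jacobian_lipschitz_dir hJ) => //.
  by move=> z' Zz'; have [] := derivatives_lip Zz' Zz.
by move=> s; apply: cylinder_segment.
Qed.

Lemma implicit_dir_lip u u' b b' : X u -> X u' ->
  enorm ((u' - u) *m M (row_mx u b) - (u' - u) *m M (row_mx u b')) <=
    lg2 / mu * (1 + kappa) * enorm (b - b') * enorm (u' - u).
Proof.
move=> Xu Xu'; have := implicit_dir_bound b' Xu Xu'.
set d := u' - u; set z := row_mx u b; set z' := row_mx u b'.
have Zz : Z z by exact: cylinder_row_mx.
have Zz' : Z z' by exact: cylinder_row_mx.
have [_ _ _ hM] := derivatives Zz.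
have [_ _ _ hM'] := derivatives Zz'.
have [_ _ hH] := derivatives_lip Zz Zz'.
set a := d *m M z; set a' := d *m M z' => a'_le.
have aE : a *m drsubmx (hessg z) = - (d *m ursubmx (hessg z)).
  by rewrite -(addr0_eq hM) mulmxN opprK mulmxA.
have aE' : a' *m drsubmx (hessg z') = - (d *m ursubmx (hessg z')).
  by rewrite -(addr0_eq hM') mulmxN opprK mulmxA.
have := hess_yy_lower b (a - a') Xu; rewrite -/z.
(* difference of the equations solved by M at z and z' *)
have -> : (a - a') *m drsubmx (hessg z) =
    - rsubmx (row_mx d a' *m (hessg z - hessg z')).
  rewrite mulmxBr linearB /= !rsubmx_mul_row_mx mulmxBl aE aE'.
  by rewrite subrr subr0 opprD.
rewrite enormN => H.
have zz' : enorm (z - z') = enorm (b - b').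
  by rewrite subr_row_mx subrr enorm_row_0mx.
rewrite zz' in hH.
have {}H : mu * enorm (a - a') <=
    lg2 * enorm (b - b') * ((1 + kappa) * enorm d).
  apply: le_trans H _; apply: (le_trans (enorm_rsubmx _)).
  apply: (le_trans (enorm_mulmx_le _ _)).
  apply: (le_trans (ler_wpM2r (enorm_ge0 _) hH)).
  apply: ler_wpM2l; first by rewrite mulr_ge0 ?enorm_ge0.
  by apply: (le_trans (enorm_row_mx _ _)); rewrite mulrDl mul1r lerD2l.
rewrite -(ler_pM2l mu_gt0); apply: le_trans H _; rewrite le_eqVlt.
by apply/orP; left; apply/eqP; field; rewrite gt_eqF.
Qed.

Lemma gradf_dir_bound u u' b c : X u -> X u' ->
  `|dotv (gradf (row_mx u b)) (row_mx (u' - u) c)| <=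
    lf0 * (enorm (u' - u) + enorm c).
Proof.
move=> Xu Xu'; set d := u' - u; set z := row_mx u b.
have Zz : Z z by exact: cylinder_row_mx.
have [hf _ _ _] := derivatives Zz.
have := @gradient_lipschitz_dir _ _ _ _ _ _ (row_mx d c) lf0 hf Zz.
move=> /(_ (fun z' Zz' => f_lip Zz' Zz)).
move=> /(_ (fun s => cylinder_segment b c Xu Xu')).
move=> /le_trans; apply; apply: ler_wpM2l; first exact: ltW.
exact: enorm_row_mx.
Qed.

Lemma hypergrad_dir_bound u u' b : X u -> X u' ->
  `|dotv (hypergrad (gradf (row_mx u b)) (M (row_mx u b))) (u' - u)| <=
    lf0 * (1 + kappa) * enorm (u' - u).
Proof.
move=> Xu Xu'; rewrite dotv_hypergrad (le_trans (gradf_dir_bound _ _ _ _)) //.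
rewrite -mulrA; apply: ler_wpM2l; first exact: ltW.
by rewrite mulrDl mul1r lerD2l implicit_dir_bound.
Qed.

Definition hypergrad_lip : R := (1 + kappa) * (lf1 + lf0 * (lg2 / mu)).

Lemma hypergrad_dir_lip u u' b b' : X u -> X u' ->
  `|dotv (hypergrad (gradf (row_mx u b)) (M (row_mx u b))) (u' - u) -
    dotv (hypergrad (gradf (row_mx u b')) (M (row_mx u b'))) (u' - u)| <=
    hypergrad_lip * enorm (b - b') * enorm (u' - u).
Proof.
move=> Xu Xu'; rewrite !dotv_hypergrad.
have ha := implicit_dir_bound b Xu Xu'.
have haa := implicit_dir_lip b b' Xu Xu'.
have [hf _ _] :=
  derivatives_lip (cylinder_row_mx b Xu) (cylinder_row_mx b' Xu).
rewrite subr_row_mx subrr enorm_row_0mx in hf.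
have hv := gradf_dir_bound b'
  ((u' - u) *m M (row_mx u b) - (u' - u) *m M (row_mx u b')) Xu Xu.
rewrite subrr enorm0 add0r in hv.
set d := u' - u in ha haa hv *.
set v := gradf (row_mx u b) in hf *; set v' := gradf (row_mx u b') in hf hv *.
set a := d *m M (row_mx u b) in ha haa hv *.
set a' := d *m M (row_mx u b') in haa hv *.
have -> : dotv v (row_mx d a) - dotv v' (row_mx d a') =
    dotv (v - v') (row_mx d a) + dotv v' (row_mx 0 (a - a')).
  have -> : row_mx 0 (a - a') = row_mx d a - row_mx d a'.
    by rewrite subr_row_mx subrr.
  by rewrite !dotvE; ring.
apply: (le_trans (ler_normD _ _)); apply: (le_trans (lerD (lexx _) hv)).
apply: (le_trans (lerD (normr_dotv_le _ _) (lexx _))).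
have h1 : enorm (v - v') * enorm (row_mx d a) <=
    lf1 * enorm (b - b') * ((1 + kappa) * enorm d).
  apply: ler_pM => //; try exact: enorm_ge0.
  by apply: (le_trans (enorm_row_mx _ _)); rewrite mulrDl mul1r lerD2l.
apply: (le_trans (lerD h1 (ler_wpM2l (ltW lf0_gt0) haa))).
by rewrite le_eqVlt; apply/orP; left; apply/eqP; rewrite /hypergrad_lip; ring.
Qed.

(** The exact hypergradient is the derivative of [outer] along segments of [X],
    so convexity makes it a subgradient there. The chain rule needs the
    derivative of [ystar], read off the expansion of the stationarity condition
    [Gy u (ystar u) = 0] along the segment. *)
Lemma hypergrad_subgradient u u' :
  X u -> X u' ->
  (forall s : R, 0 < s <= 1 ->
     f (row_mx (u + s *: (u' - u)) (ystar (u + s *: (u' - u)))) <=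
     (1 - s) * f (row_mx u (ystar u)) + s * f (row_mx u' (ystar u'))) ->
  f (row_mx u (ystar u)) - f (row_mx u' (ystar u')) <=
    dotv (hypergrad (gradf (row_mx u (ystar u))) (M (row_mx u (ystar u))))
      (u - u').
Proof.
move=> Xu Xu' f_conv; rewrite -(opprB u') dotvNr dotv_hypergrad.
set d := u' - u in f_conv *; set z := row_mx u (ystar u).
set a := d *m M z; set v := gradf z.
have Zz : Z z by exact: cylinder_row_mx.
have [hf _ hJ hM] := derivatives Zz.
pose p s := u + s *: d.
have Xp s : 0 < s <= 1 -> X (p s).
  by move=> /andP[s0 s1]; apply: X_segment; rewrite // s1 ltW.
pose w s := row_mx (p s) (ystar (p s)).
have Hw : forall s : R, 0 < s <= 1 -> Z (w s) /\
    enorm (w s - z) <= (1 + kappa) * enorm d * s.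
  move=> s s01; have Xs := Xp s s01; split; first exact: cylinder_row_mx.
  rewrite subr_row_mx (le_trans (enorm_row_mx _ _)) //.
  apply: (le_trans (lerD (lexx _) (ystar_lip Xs Xu))).
  move: s01 => /andP[s0 _]; rewrite /p addr_subl enormZ gtr0_norm //.
  by rewrite le_eqVlt; apply/orP; left; apply/eqP; ring.
apply: (@ler_add_eps _ _ _ (1 + lf0 / mu)) => e e0.
have [s1 /andP[s1_gt0 s1_le1] Hf] := small_along hf Hw e0.
have [s2 /andP[s2_gt0 s2_le1] HJ] := small_along hJ Hw e0.
set s := Num.min s1 s2.
have s_gt0 : 0 < s by rewrite lt_min s1_gt0.
have s_s1 : s <= s1 by rewrite ge_min lexx.
have s_s2 : s <= s2 by rewrite ge_min lexx orbT.
have s01 : 0 < s <= 1 by rewrite s_gt0 (le_trans s_s1).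
have {}Hf := Hf s ltac:(by rewrite s_gt0).
have {}HJ := HJ s ltac:(by rewrite s_gt0).
have Xs := Xp s s01.
have {}f_conv := f_conv s s01; rewrite -/(p s) -/(w s) -/z in f_conv.
set b := ystar (p s) - ystar u.
have wz : w s - z = row_mx (s *: d) b by rewrite subr_row_mx addr_subl.
have {}HJ : mu * enorm (b - s *: a) <= e * s.
  apply: (le_trans (hess_yy_lower (ystar u) _ Xu)).
  apply: le_trans HJ; rewrite -enormN; apply: le_trans (enorm_rsubmx _).
  rewrite !linearB /= -!/(Gy _ _) !inner_gradient_ystar // subrr sub0r.
  rewrite wz rsubmx_mul_row_mx enormN enormN -/z mulmxBl -!scalemxAl /a.
  by rewrite -(addr0_eq hM) mulmxN scalerN mulmxA addrC.
have hv := gradf_dir_bound (ystar u) (b - s *: a) Xu Xu.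
rewrite subrr enorm0 add0r -/z -/v in hv.
have {}hv : `|dotv v (row_mx 0 (b - s *: a))| <= lf0 / mu * e * s.
  apply: le_trans hv _; rewrite -!mulrA; apply: ler_wpM2l; first exact: ltW.
  by rewrite mulrC ler_pdivlMr // mulrC.
have wE : w s - z = s *: row_mx d a + row_mx 0 (b - s *: a).
  by rewrite wz scale_row_mx add_row_mx addr0 addrC subrK.
rewrite wE dotvDr dotvZr in Hf.
move: Hf hv; rewrite !ler_norml => /andP[Hf _] /andP[hv _].
rewrite -(ler_pM2l s_gt0); lra.
Qed.

(** The last term is the price of evaluating the hypergradient at [b] instead
    of [ystar u]; [p] is the next upper-level iterate. *)
Lemma round_regret u u' b p (alpha : R) :
  X u -> X u' ->
  (forall s : R, 0 < s <= 1 ->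
     f (row_mx (u + s *: (u' - u)) (ystar (u + s *: (u' - u)))) <=
     (1 - s) * f (row_mx u (ystar u)) + s * f (row_mx u' (ystar u'))) ->
  0 < alpha ->
  is_proj X
    (u - alpha *: hypergrad (gradf (row_mx u b)) (M (row_mx u b))) p ->
  f (row_mx u (ystar u)) - f (row_mx u' (ystar u')) <=
    (enorm (u - u') ^+ 2 - enorm (p - u') ^+ 2) / (2 * alpha)
    + alpha / 2 * (lf0 * (1 + kappa)) ^+ 2
    + hypergrad_lip * enorm (b - ystar u) * enorm (u - u').
Proof.
move=> Xu Xu' f_conv a0 hp; have Xp : X p by case: hp.
apply: (le_trans (hypergrad_subgradient Xu Xu' f_conv)).
have := projected_step a0 (fun s => X_segment Xp Xu') hp
  (hypergrad_dir_bound b Xu Xp).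
have := hypergrad_dir_lip b (ystar u) Xu Xu'.
rewrite -(opprB u) !dotvNr enormN ler_norml => /andP[_]; lra.
Qed.

Lemma inner_loop_contracts u b (k : nat) : X u ->
  enorm (iter k (fun c => c - (2 / (lg1 + mu)) *: rsubmx (gradg (row_mx u c))) b
         - ystar u) <=
    expR (- (2 / (kappa + 1))) ^+ k * enorm (b - ystar u).
Proof.
move=> Xu; elim: k => [|k IH]; first by rewrite expr0 mul1r.
rewrite iterS exprS -mulrA; set c := iter k _ b in IH *.
apply: le_trans _ (ler_wpM2l (expR_ge0 _) IH).
apply: (gradient_step_contracts (h := fun b' => g (row_mx u b'))
  (G := Gy u)) => //; [exact: g_sc | | | exact: ystar_argmin].
  by move=> c'; exact: inner_gradient.
move=> c' c''; have := inner_gradient_lip c' c'' Xu Xu.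
by rewrite subrr enorm_row_0mx.
Qed.

End Round.

(** * Sums over the rounds *)

Section Sequences.
Variable R : realType.
Implicit Types (T t : nat).

Lemma sum_inv_sqrt_le T :
  \sum_(1 <= t < T.+1) (Num.sqrt (t%:R : R))^-1 <= 2 * Num.sqrt T%:R.
Proof.
elim: T => [|T IH]; first by rewrite big_geq // sqrtr0 mulr0.
rewrite big_nat_recr //=; apply: (le_trans (lerD IH (lexx _))).
set a := Num.sqrt T%:R; set b := Num.sqrt T.+1%:R.
have b0 : 0 < b by rewrite sqrtr_gt0 ltr0n.
have ab : b ^+ 2 = a ^+ 2 + 1 by rewrite !sqr_sqrtr // -natr1.
rewrite addrC -lerBrDr -[X in X <= _]mul1r ler_pdivrMr //.
have := sqr_ge0 (b - a); nra.
Qed.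

(** Summation by parts for the increasing weights [sqrt t]; the term in
    [a T.+1] is what the induction step needs to absorb the larger weight. *)
Lemma sum_sqrt_telescope (a : nat -> R) (A : R) T :
  (forall t, (1 <= t <= T.+1)%N -> a t <= A) ->
  \sum_(1 <= t < T.+1) Num.sqrt t%:R * (a t - a t.+1) <=
    Num.sqrt T%:R * (A - a T.+1).
Proof.
elim: T => [|T IH] aA; first by rewrite big_geq // sqrtr0 mul0r.
rewrite big_nat_recr //=.
apply: (le_trans (lerD (IH _) (lexx _))).
  by move=> t /andP[t1 tT]; apply: aA; rewrite t1 leqW.
have H : Num.sqrt T%:R <= Num.sqrt T.+1%:R :> R.
  by rewrite ler_wsqrtr // ler_nat.
have := aA T.+1 ltac:(by rewrite /= leqW).
nra.
Qed.

(** An error that is halved at each step sums to twice what is fed into it;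
    the term [e T.+1] on the left makes the induction go through. *)
Lemma tracking_sum (e c v : nat -> R) (E : R) T :
  e 1%N <= E / 2 ->
  (forall t, (1 <= t <= T)%N -> e t.+1 <= e t / 2 + c t.+1 + v t.+1 / 2) ->
  \sum_(1 <= t < T.+2) e t + e T.+1 <=
    E + 2 * (\sum_(2 <= t < T.+2) c t) + \sum_(2 <= t < T.+2) v t.
Proof.
move=> e1; elim: T => [|T IH] eS.
  by rewrite big_nat1 !(big_geq (m := 2)) // mulr0 !addr0; lra.
rewrite big_nat_recr //= [in leRHS]big_nat_recr //=.
rewrite [\sum_(2 <= t < _) v t]big_nat_recr //=.
have := IH (fun t tT => eS t ltac:(by case/andP: tT => -> /leqW)).
have := eS T.+1 ltac:(by rewrite /= leqnn).
lra.
Qed.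

(** The prescribed number of inner steps divides the distance to the lower-level
    minimiser by [2 t]: the total exponent is at least [ln (2 t)]. *)
Lemma inner_rate (kappa : R) (K t : nat) : 0 <= kappa -> (0 < t)%N ->
  Num.ceil (4^-1 * (kappa + 1) * ln (4 * t%:R ^+ 2)) < K%:Z ->
  expR (- (2 / (kappa + 1))) ^+ K <= (2 * t%:R)^-1.
Proof.
move=> k0 t0 HK.
have t2 : (0 : R) < 2 * t%:R by rewrite mulr_gt0 // ltr0n.
have k1 : 0 < kappa + 1 by rewrite ltr_wpDl.
have {}HK : 4^-1 * (kappa + 1) * ln (4 * t%:R ^+ 2) <= K%:R.
  apply: le_trans (ceil_ge _) _.
  by rewrite -[K%:R]/((K%:Z)%:~R) ler_int ltW.
have lnE : ln (4 * t%:R ^+ 2) = 2 * ln (2 * t%:R) :> R.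
  rewrite [RHS]mulr_natl -(lnXn _ t2) exprMn; congr (ln (_ * _)).
  by rewrite -natrX.
rewrite lnE in HK.
rewrite -expRM_natl -[leRHS]lnK ?posrE ?invr_gt0 // ler_expR lnV ?posrE //.
rewrite mulrN lerN2 mulrA ler_pdivlMr //; lra.
Qed.

End Sequences.

(** * Convexity along segments *)

Lemma convex_set_segment (R : realType) d (X : set 'rV[R]_d) u v (s : R) :
  convex_set X -> X u -> X v -> 0 <= s <= 1 -> X (u + s *: (v - u)).
Proof.
move=> cX Xu Xv /andP[s0 s1].
have := cX v u (Itv01 s0 s1); rewrite !inE => /(_ Xv Xu).
rewrite /conv /= /unstable.onem; congr X.
by rewrite scalerBl scale1r scalerBr addrCA.
Qed.

Lemma convex_function_segment (R : realType) d (X : set 'rV[R]_d)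
    (h : 'rV[R]_d -> R) u v (s : R) :
  convex_function X h -> X u -> X v -> 0 <= s <= 1 ->
  h (u + s *: (v - u)) <= (1 - s) * h u + s * h v.
Proof.
move=> ch Xu Xv /andP[s0 s1].
have := ch (Itv01 s0 s1) v u; rewrite !inE => /(_ Xv Xu).
rewrite convRE /conv /= /unstable.onem [leRHS]addrC.
by rewrite scalerBl scale1r scalerBr addrCA.
Qed.

(** * The regret bound *)

Theorem theorem8 (R : realType) (lf0 lf1 lg1 lg2 mu D D' : R)
    (hlf0 : 0 < lf0) (hlf1 : 0 <= lf1) (hlg1 : 0 <= lg1) (hlg2 : 0 <= lg2)
    (hmu : 0 < mu) (hD : 0 < D) :
  exists2 C : R, 0 < C &
  forall (d1 d2 T : nat) (X : set 'rV[R]_d1)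
    (f g : nat -> 'rV[R]_(d1 + d2) -> R)
    (gradf gradg : nat -> 'rV[R]_(d1 + d2) -> 'rV[R]_(d1 + d2))
    (hessg : nat -> 'rV[R]_(d1 + d2) -> 'M[R]_(d1 + d2))
    (M : nat -> 'rV[R]_(d1 + d2) -> 'M[R]_(d1, d2))
    (ystar : nat -> 'rV[R]_d1 -> 'rV[R]_d2)
    (alpha beta : nat -> R) (K : nat -> nat)
    (x : nat -> 'rV[R]_d1) (y : nat -> 'rV[R]_d2) (xs : 'rV[R]_d1),
  let Z := cylinder d2 X in
  (* the domain *)
  X !=set0 -> closed X -> convex_set X ->
  (* y_t^*, the derivatives of f_t and g_t, and M_t *)
  (forall t, (1 <= t <= T)%N -> forall u, X u ->
     is_argmin setT (fun v => g t (row_mx u v)) (ystar t u)) ->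
  (forall t, (1 <= t <= T)%N -> forall z, Z z ->
     [/\ gradient_within Z (f t) z (gradf t z),
         gradient_within Z (g t) z (gradg t z),
         jacobian_within Z (gradg t) z (hessg t z) &
         solves_M (hessg t z) (M t z)]) ->
  (* (i) *)
  (forall t, (1 <= t <= T)%N -> forall z z', Z z -> Z z' ->
     `|f t z - f t z'| <= lf0 * enorm (z - z')) ->
  (* (ii) *)
  (forall t, (1 <= t <= T)%N -> forall u, X u ->
     strongly_convex mu (fun v => g t (row_mx u v))) ->
  (* (iii) *)
  (forall t, (1 <= t <= T)%N -> forall z z', Z z -> Z z' ->
     [/\ enorm (gradf t z - gradf t z') <= lf1 * enorm (z - z'),
         enorm (gradg t z - gradg t z') <= lg1 * enorm (z - z') &
         opnorm (hessg t z - hessg t z') <= lg2 * enorm (z - z')]) ->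
  (* (iv) *)
  (forall u u', X u -> X u' -> enorm (u - u') <= D) ->
  enorm (y 1%N - ystar 1%N (x 1%N)) <= D' ->
  (* (v) *)
  (forall t, (1 <= t <= T)%N -> convex_function X (outer f ystar t)) ->
  (* the parameters of the algorithm *)
  (forall t, (1 <= t <= T)%N ->
     [/\ beta t = 2 / (lg1 + mu),
         alpha t = D / (lf0 * Num.sqrt t%:R) &
         Num.ceil (4^-1 * (lg1 / mu + 1) * ln (4 * t%:R ^+ 2))
           < (K t)%:Z]) ->
  oagd X T gradf gradg M alpha beta K x y ->
  is_argmin X (fun u => \sum_(1 <= t < T.+1) outer f ystar t u) xs ->
  bs_regret T f ystar x xs <=
    C * (Num.sqrt T%:R + path_var 1 T ystar xs + path_var 2 T ystar xs).
Proof.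
set kappa := lg1 / mu; set Lf := hypergrad_lip lf0 lf1 lg1 lg2 mu.
set G := lf0 * (1 + kappa).
have kappa0 : 0 <= kappa by rewrite divr_ge0 // ltW.
have Lf0 : 0 <= Lf.
  by rewrite /Lf /hypergrad_lip !(mulr_ge0, addr_ge0) // ?invr_ge0 ltW.
(* telescoped distances, squared hypergradients, lower-level errors (constant
   part and path part); the last 1 makes C positive *)
pose C := lf0 * D / 2 + D / lf0 * G ^+ 2
  + Lf * D * (`|D'| + 4 * kappa * D) + Lf * D + 1.
have C1 : 0 <= lf0 * D / 2 by rewrite !mulr_ge0 // ?invr_ge0 // ltW.
have C2 : 0 <= D / lf0 * G ^+ 2.
  by rewrite mulr_ge0 ?sqr_ge0 // divr_ge0 // ltW.
have D0 : 0 <= D := ltW hD.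
have C4 : 0 <= Lf * D by rewrite mulr_ge0.
have C3 : 0 <= Lf * D * (`|D'| + 4 * kappa * D).
  rewrite mulr_ge0 //; have := mulr_ge0 kappa0 D0; have := normr_ge0 D'; lra.
exists C; first by rewrite /C; lra.
move=> d1 d2 T X f g gradf gradg hessg M ystar alpha beta K x y xs Z.
move=> _ _ cX ys_min ders f_lip g_sc ders_lip diamX y1 convF params run xs_min.
have Xseg u v s := @convex_set_segment _ _ X u v s cX.
have [Xx1 step] := run.
have [Xxs _] := xs_min.
have path_ge0 p : 0 <= path_var p T ystar xs.
  by apply: sumr_ge0 => t _; rewrite exprn_ge0 // enorm_ge0.
case: T => [|T] in ys_min ders f_lip g_sc ders_lip convF params run xs_min step
  path_ge0 *.
  rewrite /bs_regret /path_var !big_geq // sqrtr0 !addr0 mulr0.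
  exact: lexx.
have Xx t : (1 <= t <= T.+2)%N -> X (x t).
  case: t => [//|[//|t]] tT; have [_ [Xp _]] := step t.+1 tT; exact: Xp.
have XxT t : (1 <= t <= T.+1)%N -> X (x t).
  by move=> /andP[t1 tT]; apply: Xx; rewrite t1 leqW.
pose e t := enorm (y t.+1 - ystar t (x t)).
pose V t := enorm (ystar t.-1 xs - ystar t xs).
have e_step t : (1 <= t <= T.+1)%N ->
    e t <= (2 * t%:R)^-1 * enorm (y t - ystar t (x t)).
  move=> tT; have [bE _ Kt] := params t tT; have [yE _] := step t tT.
  rewrite /e yE bE.
  apply: (le_trans (inner_loop_contracts hlg1 hmu (ys_min t tT) (ders t tT)
    (g_sc t tT) (ders_lip t tT) (y t) (K t) (XxT t tT))).
  apply: ler_wpM2r; first exact: enorm_ge0.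
  by apply: inner_rate => //; case/andP: tT.
have ys_lip t u v : (1 <= t <= T.+1)%N -> X u -> X v ->
    enorm (ystar t u - ystar t v) <= kappa * D.
  move=> tT Xu Xv.
  apply: (le_trans (ystar_lip hlg1 hmu (ys_min t tT) (ders t tT)
    (g_sc t tT) (ders_lip t tT) Xu Xv)).
  by apply: ler_wpM2l => //; exact: diamX.
have e_sum : \sum_(1 <= t < T.+2) e t <=
    `|D'| + 4 * kappa * D * Num.sqrt T.+1%:R + path_var 1 T.+1 ystar xs.
  have e1 : e 1%N <= `|D'| / 2.
    apply: (le_trans (e_step 1%N isT)); rewrite mulr1 mulrC ler_wpM2r //.
    exact: le_trans y1 (ler_norm _).
  have eS t : (1 <= t <= T)%N ->
      e t.+1 <= e t / 2 + kappa * D * (Num.sqrt t.+1%:R)^-1 + V t.+1 / 2.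
    move=> /andP[t1 tT].
    have tT1 : (1 <= t <= T.+1)%N by rewrite t1 leqW.
    have tT2 : (1 <= t.+1 <= T.+1)%N by [].
    apply: (le_trans (e_step _ tT2)).
    have tri : enorm (y t.+1 - ystar t.+1 (x t.+1)) <=
        e t + 2 * (kappa * D) + V t.+1.
      apply: (le_trans (enorm_dist _ (ystar t (x t)) _)).
      apply: (le_trans (lerD (lexx _) (enorm_dist _ (ystar t xs) _))).
      have h1 := ys_lip t (x t) xs tT1 (XxT _ tT1) Xxs.
      have h2 := ys_lip t.+1 xs (x t.+1) tT2 Xxs (XxT _ tT2).
      have h3 := enorm_dist (ystar t xs) (ystar t.+1 xs) (ystar t.+1 (x t.+1)).
      rewrite /V /= -/(e t); lra.
    set r := (2 * t.+1%:R)^-1 : R; set q := (Num.sqrt t.+1%:R)^-1 : R.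
    have r0 : 0 <= r by rewrite invr_ge0 mulr_ge0.
    have sq1 : 1 <= Num.sqrt t.+1%:R :> R.
      by rewrite -[leLHS]sqrtr1 ler_wsqrtr // ler1n.
    have s0 : 0 < Num.sqrt t.+1%:R :> R by apply: lt_le_trans sq1.
    have sq2 : Num.sqrt t.+1%:R ^+ 2 = t.+1%:R :> R by rewrite sqr_sqrtr.
    have r_half : r <= 2^-1.
      by rewrite lef_pV2 ?posrE ?mulr_gt0 // ler_peMr // ler1n.
    (* 2 r = 1 / (t + 1) <= 1 / sqrt (t + 1) *)
    have rq : 2 * r <= q.
      rewrite /r /q invfM mulrA divff // mul1r lef_pV2 ?posrE ?ltr0n //.
      by rewrite -[leRHS]sq2 expr2 ler_peMr // ltW.
    apply: (le_trans (ler_wpM2l r0 tri)).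
    have e0 : 0 <= e t := enorm_ge0 _.
    have V0 : 0 <= V t.+1 := enorm_ge0 _.
    have kD : 0 <= kappa * D by rewrite mulr_ge0 // ltW.
    nra.
  have := tracking_sum (c := fun t => kappa * D * (Num.sqrt t%:R)^-1) e1 eS.
  have : 0 <= e T.+1 := enorm_ge0 _.
  have -> : \sum_(2 <= t < T.+2) V t = path_var 1 T.+1 ystar xs.
    by apply: eq_bigr => t _; rewrite expr1.
  rewrite -big_distrr /=.
  have : \sum_(2 <= t < T.+2) (Num.sqrt t%:R)^-1 <= 2 * Num.sqrt T.+1%:R :> R.
    apply: le_trans (sum_inv_sqrt_le R T.+1).
    by rewrite [leRHS]big_ltn // lerDr invr_ge0 sqrtr_ge0.
  have kD : 0 <= kappa * D by rewrite mulr_ge0 // ltW.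
  move=> /(ler_wpM2l kD); lra.
pose a t := enorm (x t - xs) ^+ 2.
have aD t : (1 <= t <= T.+2)%N -> a t <= D ^+ 2.
  move=> tT; rewrite /a ler_sqr ?nnegrE ?enorm_ge0 ?(ltW hD) //.
  exact: diamX (Xx t tT) Xxs.
have round t : (1 <= t <= T.+1)%N ->
    outer f ystar t (x t) - outer f ystar t xs <=
    lf0 / (2 * D) * (Num.sqrt t%:R * (a t - a t.+1))
    + D / (2 * lf0) * G ^+ 2 * (Num.sqrt t%:R)^-1 + Lf * D * e t.
  move=> tT; have [_ aE _] := params t tT; have [_ hp] := step t tT.
  have s0 : 0 < Num.sqrt t%:R :> R.
    by rewrite sqrtr_gt0 ltr0n; case/andP: tT.
  have a0 : 0 < alpha t by rewrite aE divr_gt0 // mulr_gt0.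
  apply: (le_trans (round_regret hlf0 hlg1 hlg2 hmu Xseg (ys_min t tT)
    (ders t tT) (f_lip t tT) (g_sc t tT) (ders_lip t tT) (XxT t tT) Xxs
    _ a0 hp)).
    move=> s /andP[s_gt0 s1].
    apply: (convex_function_segment (convF t tT) (XxT t tT) Xxs).
    by rewrite (ltW s_gt0).
  rewrite -/kappa -/G -/Lf -/(e t) -/(a t) -/(a t.+1).
  apply: lerD.
    rewrite le_eqVlt aE; apply/orP; left; apply/eqP.
    by field; rewrite !gt_eqF.
  rewrite mulrAC; apply: ler_wpM2r; first exact: enorm_ge0.
  by apply: ler_wpM2l => //; exact: diamX (XxT t tT) Xxs.
have -> : bs_regret T.+1 f ystar x xs =
  \sum_(1 <= t < T.+2) (outer f ystar t (x t) - outer f ystar t xs) by [].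
apply: (@le_trans _ _ (\sum_(1 <= t < T.+2)
    (lf0 / (2 * D) * (Num.sqrt t%:R * (a t - a t.+1))
    + D / (2 * lf0) * G ^+ 2 * (Num.sqrt t%:R)^-1 + Lf * D * e t))).
  by apply: ler_sum_nat => t tT; apply: round.
rewrite !big_split /= -!big_distrr /=.
have tel := sum_sqrt_telescope aD.
have inv := sum_inv_sqrt_le R T.+1.
have S1 : 1 <= Num.sqrt T.+1%:R :> R.
  by rewrite -[leLHS]sqrtr1 ler_wsqrtr // ler1n.
have a_ge0 : 0 <= a T.+2 := sqr_ge0 _.
have Y1 := path_ge0 1%N; have Y2 := path_ge0 2%N.
set S := Num.sqrt T.+1%:R in e_sum tel inv S1 *.
have {}tel : lf0 / (2 * D) *
    \sum_(1 <= i < T.+2) Num.sqrt i%:R * (a i - a i.+1) <= lf0 * D / 2 * S.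
  have -> : lf0 * D / 2 * S = lf0 / (2 * D) * (S * D ^+ 2).
    by field; rewrite gt_eqF.
  apply: ler_wpM2l; first by rewrite divr_ge0 ?mulr_ge0 // ltW.
  by apply: le_trans tel _; rewrite ler_wpM2l ?sqrtr_ge0 // lerBlDr lerDl.
have {}inv : D / (2 * lf0) * G ^+ 2 *
    \sum_(1 <= i < T.+2) (Num.sqrt i%:R)^-1 <= D / lf0 * G ^+ 2 * S.
  have -> : D / lf0 * G ^+ 2 * S = D / (2 * lf0) * G ^+ 2 * (2 * S).
    by field; rewrite gt_eqF.
  apply: ler_wpM2l => //.
  by rewrite mulr_ge0 ?sqr_ge0 // divr_ge0 ?mulr_ge0 // ltW.
have {}e_sum := ler_wpM2l C4 e_sum.
apply: (le_trans (lerD (lerD tel inv) e_sum)).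
set Y := path_var 1 _ _ _ in Y1 *; set Y' := path_var 2 _ _ _ in Y2 *.
rewrite /C; move: C1 C2 C3 C4.
set c1 := lf0 * D / 2; set c2 := D / lf0 * G ^+ 2; set c4 := Lf * D.
move=> c1_0 c2_0 c3_0 c4_0.
have h0 : c4 * `|D'| <= c4 * `|D'| * S by rewrite ler_peMr // mulr_ge0.
have h1 : 0 <= (c1 + c2 + c4 * (`|D'| + 4 * kappa * D)) * (Y + Y').
  by rewrite mulr_ge0 // !addr_ge0.
have h2 : 0 <= c4 * (S + Y') by rewrite mulr_ge0 // addr_ge0 // sqrtr_ge0.
have h3 : 0 <= S + Y + Y' by rewrite !addr_ge0 // sqrtr_ge0.
nra.
Qed.
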